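(* Let $Q=T[H_1,\dots,H_t]$ be a semicomplete composition such that $T$ has no sink. Then $Q$ contains a pair of disjoint quasi-kernels. In particular, every strong semicomplete composition contains a pair of disjoint quasi-kernels.
   Context: All digraphs are finite, without loops or parallel arcs; $d_D(x,y)$ is the length of a shortest directed $x$–$y$ path. Let $T$ be a digraph with vertices $u_1,\dots,u_t$ ($t\ge 2$) and $H_1,\dots,H_t$ digraphs, $H_i$ having vertices $u_{i,j}$, $1\le j\le n_i$. The composition $Q=T[H_1,\dots,H_t]$ has vertex set $\{u_{i,j}\}$ and arc set $\bigcup_i A(H_i)\cup\{u_{i,j}u_{p,q}: u_iu_p\in A(T)\}$ (all $j,q$). It is a semicomplete composition if $T$ is semicomplete (at least one arc between every two distinct vertices). A sink is a vertex of out-degree $0$. A digraph is strong if every vertex can reach every other vertex. A quasi-kernel of a digraph $D$ is an independent set $K\subseteq V(D)$ (no arcs between vertices of $K$) such that for every $x\in V(D)\setminus K$ there is $y\in K$ with $d_D(x,y)\le 2$. *)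

(* Defs.v *)
From HB Require Import structures.
From mathcomp Require Import all_boot.

Set Implicit Arguments.
Unset Strict Implicit.
Unset Printing Implicit Defensive.

(* Arcs form a binary relation, so parallel arcs are excluded, but a pair of
   opposite arcs xy, yx is allowed. *)
Record digraph := Digraph {
  vertex :> finType;
  arc : rel vertex;
  arc_irr : irreflexive arc
}.

Definition outdeg (D : digraph) (x : D) : nat := #|[set y : D | arc x y]|.

Definition sink (D : digraph) (x : D) : Prop := outdeg x = 0.

Definition semicomplete (D : digraph) : Prop :=
  forall x y : D, x != y -> arc x y || arc y x.

Definition strong (D : digraph) : Prop :=
  forall x y : D, connect (@arc D) x y.

(* The path x :: p from x to y; its length is size p. *)
Definition dipath (D : digraph) (x y : D) (p : seq D) : bool :=
  [&& path (@arc D) x p, uniq (x :: p) & last x p == y].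

(* d(x, y) = n; there is no such n when y is not reachable from x. *)
Definition is_dist (D : digraph) (x y : D) (n : nat) : Prop :=
  (exists2 p, dipath x y p & size p = n) /\
  (forall p, dipath x y p -> n <= size p).

Definition independent (D : digraph) (K : {set D}) : Prop :=
  forall x y : D, x \in K -> y \in K -> ~~ arc x y.

Definition quasi_kernel (D : digraph) (K : {set D}) : Prop :=
  independent K /\
  forall x : D, x \notin K ->
    exists2 y : D, y \in K & exists2 n, is_dist x y n & n <= 2.

(* The vertex Tagged _ j with tag i is u_{i,j}; when tag x = tag y,
   tagged_as x y is tagged y cast to H (tag x). *)
Definition comp_arc (T : digraph) (H : T -> digraph) : rel {i : T & H i} :=
  fun x y =>
    arc (tag x) (tag y) ||
    ((tag x == tag y) && arc (tagged x) (tagged_as x y)).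

Lemma comp_arc_irr (T : digraph) (H : T -> digraph) :
  irreflexive (@comp_arc T H).
Proof. by case=> i j; rewrite /comp_arc tagged_asE /= !arc_irr andbF. Qed.

Definition composition (T : digraph) (H : T -> digraph) : digraph :=
  Digraph (@comp_arc_irr T H).

(* Main.v *)
Require Import Defs.
From HB Require Import structures.
From mathcomp Require Import all_boot.
(* [arc] must denote the arcs of a digraph, not [path.arc]. *)
Import Defs.

Set Implicit Arguments.
Unset Strict Implicit.
Unset Printing Implicit Defensive.

(** If every vertex of [T] reaches [u] in at most two steps, then a
    Chvatal-Lovasz quasi-kernel of [H u] is a quasi-kernel of the whole
    composition, so two such vertices [u != v] suffice. For semicomplete [T] one
    such [u] always exists; since [u] is not a sink, let [v] be such a vertex for
    the subdigraph induced by the out-neighbours of [u]: every vertex that is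
    neither [u] nor an out-neighbour of [u] reaches [v] through [u]. *)

(** Asks only for a walk of length 1 or 2, so that lifting to the composition needs no distinctness
    check; [within2_dist] turns it into a distance when [x != y]. *)
Definition within2 (D : digraph) (x y : D) : bool :=
  arc x y || [exists z, arc x z && arc z y].

Lemma within2_dist (D : digraph) (x y : D) :
  x != y -> within2 x y -> exists2 n, is_dist x y n & n <= 2.
Proof.
move=> neq_xy xy2.
have neq_arc (a b : D) : arc a b -> a != b.
  by apply: contraTneq => ->; rewrite arc_irr.
case arc_xy: (arc x y).
  exists 1 => //; split.
    by exists [:: y] => //; rewrite /dipath /= arc_xy inE neq_xy eqxx.
  by case=> // /and3P[_ _ /= /eqP xy]; rewrite xy eqxx in neq_xy.
move: xy2; rewrite /within2 arc_xy /= => /existsP[z /andP[xz zy]].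
exists 2 => //; split.
  exists [:: z; y] => //.
  by rewrite /dipath /= xz zy !inE negb_or neq_xy !neq_arc ?eqxx.
(* A path of length 0 would give [x = y] and one of length 1 an arc from [x] to [y]; both are
   excluded. *)
case=> [|a [|b p]] // /and3P[/=].
  by move=> _ _ /eqP xy; rewrite xy eqxx in neq_xy.
by rewrite andbT => xa _ /eqP ay; rewrite -ay xa in arc_xy.
Qed.

(** Induction on [#|S|]: remove some [v] and its in-neighbours from [S], and take [K] for the rest.
    If [v] has an arc into [K], the removed vertices reach [K] directly or through [v]; otherwise
    [v |: K] is still independent and absorbs them. Working with a subset [S] avoids induced
    subdigraphs. *)
Lemma chvatal_lovasz (D : digraph) (S : {set D}) :
  exists K : {set D}, [/\ K \subset S, independent K &
    forall x, x \in S -> x \notin K -> exists2 y, y \in K & within2 x y].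
Proof.
have [n] := ubnP #|S|; elim: n S => // n IHn S /ltnSE leSn.
have [->|[v vS]] := set_0Vmem S.
  by exists set0; split=> // x; rewrite inE.
pose S' := [set x in S | (x != v) && ~~ arc x v].
have S'S : S' \subset S by apply/subsetP=> x; rewrite inE => /andP[].
have ltS'S : #|S'| < #|S|.
  apply/proper_card/properP; split=> //; exists v => //.
  by rewrite inE eqxx andbF.
have [K [KS' indK domK]] := IHn S' (leq_trans ltS'S leSn).
have [/exists_inP[y yK vy]|/exists_inPn novK] := boolP [exists y in K, arc v y].
  exists K; split=> // [|x xS xK]; first exact: subset_trans S'S.
  have [xS'|] := boolP (x \in S'); first exact: domK.
  rewrite inE xS /= negb_and !negbK => /orP[/eqP->|xv].
    by exists y => //; rewrite /within2 vy.
  by exists y => //; apply/orP; right; apply/existsP; exists v; rewrite xv.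
exists (v |: K); split.
- by rewrite subUset sub1set vS (subset_trans KS').
(* Arcs from [K] to [v] are excluded by the choice of [S'], arcs from [v] to [K] by the case
   assumption. *)
- have noKv x : x \in K -> ~~ arc x v.
    by move/(subsetP KS'); rewrite inE => /and3P[].
  move=> x y /setU1P[->|xK] /setU1P[->|yK]; [|exact: novK|exact: noKv|exact: indK].
  by rewrite arc_irr.
move=> x xS; rewrite !inE negb_or => /andP[xv xK].
have [xS'|] := boolP (x \in S').
  by have [y yK xy] := domK x xS' xK; exists y; rewrite // inE yK orbT.
rewrite inE xS xv negbK /= => arc_xv.
by exists v; rewrite ?setU11 // /within2 arc_xv.
Qed.

(** An independent set of a semicomplete digraph has at most one vertex, so the set given by
    [chvatal_lovasz] is a single vertex; it is nonempty because [S] is. *)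
Lemma semicomplete_king (D : digraph) (S : {set D}) :
    semicomplete D -> S != set0 ->
  exists2 v, v \in S & forall x, x \in S -> x != v -> within2 x v.
Proof.
move=> semiD /set0Pn[w wS].
have [K [KS indK domK]] := chvatal_lovasz S.
have [v vK] : exists v, v \in K.
  have [wK|wK] := boolP (w \in K); first by exists w.
  by have [v vK _] := domK w wS wK; exists v.
exists v => [|x xS xv]; first exact: (subsetP KS).
have eqv y : y \in K -> y = v.
  move=> yK; apply/eqP; apply/negPn/negP=> /semiD /orP[]; apply/negP; exact: indK.
have xK : x \notin K by apply: contra xv => /eqv->.
by have [y /eqv-> ] := domK x xS xK.
Qed.

Lemma two_kings (D : digraph) :
    semicomplete D -> 0 < #|D| -> (forall x : D, ~ sink x) ->
  exists u v : D, [/\ u != v, forall x, x != u -> within2 x u &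
                              forall x, x != v -> within2 x v].
Proof.
move=> semiD /card_gt0P[w _] nosink.
have [|u _ kingu] := @semicomplete_king D setT semiD.
  by apply/set0Pn; exists w; rewrite inE.
have [|v] := @semicomplete_king D [set y | arc u y] semiD.
  by apply/eqP => Nu0; apply: (nosink u); rewrite /sink /outdeg Nu0 cards0.
rewrite inE => uv kingv; exists u, v; split=> [|x xu|x xv].
- by apply: contraTneq uv => ->; rewrite arc_irr.
- exact: kingu.
have [ux|nux] := boolP (arc u x); first by apply: kingv; rewrite ?inE.
have [->|xu] := eqVneq x u; first by rewrite /within2 uv.
have := semiD _ _ xu; rewrite (negPf nux) orbF => arc_xu.
by apply/orP; right; apply/existsP; exists u; rewrite arc_xu.
Qed.

Section Composition.

Variables (T : digraph) (H : T -> digraph).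

Let inc (i : T) (j : H i) : composition H := Tagged (fun i => H i) j.

Lemma comp_arc_fiber (i : T) (j k : H i) : arc (inc j) (inc k) = arc j k.
Proof. by rewrite /= /comp_arc tagged_asE /= arc_irr eqxx. Qed.

Lemma within2_fiber (i : T) (j k : H i) :
  within2 j k -> within2 (inc j) (inc k).
Proof.
case/orP=> [jk|/existsP[l /andP[jl lk]]]; first by rewrite /within2 comp_arc_fiber jk.
by apply/orP; right; apply/existsP; exists (inc l); rewrite !comp_arc_fiber jl.
Qed.

(** The midpoint [i] of a walk in [T] lifts to any vertex of [H i], hence the nonemptiness
    assumption. *)
Lemma within2_tag (x y : composition H) : (forall i : T, 0 < #|H i|) ->
  within2 (tag x) (tag y) -> within2 x y.
Proof.
move=> H_nonempty; case/orP=> [xy|/existsP[i /andP[xi iy]]].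
  by rewrite /within2 /= /comp_arc xy.
have /card_gt0P[j _] := H_nonempty i.
apply/orP; right; apply/existsP; exists (inc j).
by rewrite /= /comp_arc /= xi iy.
Qed.

(** Inside the copy of [H u], [chvatal_lovasz] applies; from outside, a walk of [T] to [u] lifts to
    a walk to any chosen vertex of [K]. The tag condition makes the quasi-kernels of two distinct
    [u] disjoint. *)
Lemma king_quasi_kernel (u : T) : (forall i : T, 0 < #|H i|) ->
    (forall i, i != u -> within2 i u) ->
  exists2 K : {set composition H}, quasi_kernel K & {in K, forall x, tag x = u}.
Proof.
move=> H_nonempty kingu.
have [K [_ indK domK]] := chvatal_lovasz [set: H u].
(* Vertices outside the copy of [H u] need a target in [K]. *)
have [k kK] : exists k, k \in K.
  have /card_gt0P[w _] := H_nonempty u.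
  have [wK|wK] := boolP (w \in K); first by exists w.
  by have [k kK _] := domK w (in_setT w) wK; exists k.
exists [set inc j | j in K]; last by move=> _ /imsetP[j _ ->].
split=> [_ _ /imsetP[a aK ->] /imsetP[b bK ->]|x xK].
  by rewrite comp_arc_fiber; exact: indK.
have [y yK xy] : exists2 y, y \in [set inc j | j in K] & within2 x y.
  have [xu|xu] := eqVneq (tag x) u; last first.
    by exists (inc k); [exact: imset_f|apply: within2_tag => //; exact: kingu].
  case: x xu xK => i j /= iu; subst i => jK.
  have [|y yK jy] := domK j (in_setT j).
    by apply: contra jK => jK; exact: imset_f.
  by exists (inc y); [exact: imset_f|exact: within2_fiber].
exists y => //; apply: within2_dist => //.
by apply: contraNneq xK => ->.
Qed.

(** If [i] is a sink, no arc leaves the copy of [H i], so no vertex of another copy is reachable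
    from it. *)
Lemma strong_composition_no_sink : 2 <= #|T| -> (forall i : T, 0 < #|H i|) ->
  strong (composition H) -> forall i : T, ~ sink i.
Proof.
move=> T_ge2 H_nonempty strongQ i /eqP; rewrite cards_eq0 => /eqP Ni0.
have [j ij] : exists j, j != i.
  have := T_ge2; rewrite (cardD1 i) inE /= ltnS => /card_gt0P[j].
  by rewrite !inE andbT => ji; exists j.
have /card_gt0P[a _] := H_nonempty i; have /card_gt0P[b _] := H_nonempty j.
have /connectP[p pathp lastp] := strongQ (inc a) (inc b).
suff tagp (x : composition H) q : tag x = i -> path (@arc _) x q -> tag (last x q) = i.
  by have := tagp (inc a) p erefl pathp; rewrite -lastp => /= ji; rewrite ji eqxx in ij.
elim: q x => //= y q IHq x xi /andP[xy]; apply: IHq.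
have noarc : arc (tag x) (tag y) = false.
  by have := in_set0 (tag y); rewrite -Ni0 inE xi.
by move: xy; rewrite /comp_arc noarc => /andP[/eqP <-].
Qed.

End Composition.

Theorem theorem3p3 (T : digraph) (H : T -> digraph)
    (t_ge2 : 2 <= #|T|) (H_nonempty : forall i : T, 0 < #|H i|)
    (T_semicomplete : semicomplete T) :
  ((forall i : T, ~ sink i) ->
     exists K1 K2 : {set composition H},
       [/\ quasi_kernel K1, quasi_kernel K2 & [disjoint K1 & K2]]) /\
  (strong (composition H) ->
     exists K1 K2 : {set composition H},
       [/\ quasi_kernel K1, quasi_kernel K2 & [disjoint K1 & K2]]).
Proof.
have main : (forall i : T, ~ sink i) -> exists K1 K2 : {set composition H},
    [/\ quasi_kernel K1, quasi_kernel K2 & [disjoint K1 & K2]].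
  move=> nosink.
  have [u [v [uv kingu kingv]]] := two_kings T_semicomplete (ltnW t_ge2) nosink.
  have [K1 qk1 tag1] := king_quasi_kernel H_nonempty kingu.
  have [K2 qk2 tag2] := king_quasi_kernel H_nonempty kingv.
  exists K1, K2; split=> //; apply/pred0P=> x /=.
  apply/negbTE/andP=> -[/tag1 xu /tag2 xv].
  by rewrite -xu -xv eqxx in uv.
split=> // strongQ; apply: main; exact: strong_composition_no_sink.
Qed.
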